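(* (Fundamental Lemma of the Calculus of Variations.) Let $a,b\in\widetilde{\mathbb R}$ with $a<b$, and let $f\in\mathcal{GC}^\infty([a,b],\widetilde{\mathbb R})$. If $$\int_a^bf(t)\eta(t)\,dt=0\quad\text{for all }\eta\in\mathcal{GC}^\infty_0,$$ then $f=0$.
   Context: Generalized numbers. Let $I_0=(0,1]\subseteq\mathbb R$; ''for $\varepsilon$ small'' means for all $\varepsilon\in(0,\varepsilon_0]$ for some $\varepsilon_0\in I_0$. Fix a net $\rho=(\rho_\varepsilon)_{\varepsilon\in I_0}$ of reals with $\rho_\varepsilon\to0^+$ as $\varepsilon\to0^+$. A net $(x_\varepsilon)$ in $\mathbb R^n$ is moderate if $|x_\varepsilon|=O(\rho_\varepsilon^{-N})$ for some $N\in\mathbb R_{>0}$; $(x_\varepsilon)\sim(y_\varepsilon)$ if $|x_\varepsilon-y_\varepsilon|=O(\rho_\varepsilon^{N})$ for every $N\in\mathbb R_{>0}$. $\widetilde{\mathbb R}$ is the ring of moderate real nets modulo $\sim$, with classes $[x_\varepsilon]$; $\widetilde{\mathbb R}^n$ is defined analogously. $\mathbb R\subseteq\widetilde{\mathbb R}$ via constant nets. $x\le y$ iff there are representatives with $x_\varepsilon\le y_\varepsilon$ for all $\varepsilon$; $x<y$ iff $y-x\ge0$ and $y-x$ is invertible. $[a,b]=\{x\in\widetilde{\mathbb R}:a\le x\le b\}$. Generalized smooth functions (GSF). For open $\Omega_\varepsilon\subseteq\mathbb R^n$, $\langle\Omega_\varepsilon\rangle$ is the set of $[x_\varepsilon]\in\widetilde{\mathbb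 R}^n$ such that for every representative $x_\varepsilon\in\Omega_\varepsilon$ for $\varepsilon$ small. For $X\subseteq\widetilde{\mathbb R}^n$, $Y\subseteq\widetilde{\mathbb R}^k$, $\mathcal{GC}^\infty(X,Y)$ is the set of maps $f:X\to Y$ for which there are $f_\varepsilon\in C^\infty(\Omega_\varepsilon,\mathbb R^k)$ with $X\subseteq\langle\Omega_\varepsilon\rangle$, $f([x_\varepsilon])=[f_\varepsilon(x_\varepsilon)]$ and $(\partial^\alpha f_\varepsilon(x_\varepsilon))$ moderate for all $[x_\varepsilon]\in X$ and all multi-indices $\alpha$. $\int_a^bf(t)\,dt=[\int_{a_\varepsilon}^{b_\varepsilon}f_\varepsilon(t)\,dt]$. Here $\mathcal{GC}^\infty_0=\{\eta\in\mathcal{GC}^\infty(\widetilde{\mathbb R},\widetilde{\mathbb R}):\eta(a)=0=\eta(b)\}$. *)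

(* Defs.v *)
From HB Require Import structures.
From mathcomp Require Import all_boot all_order all_algebra.
From mathcomp Require Import generic_quotient ring_quotient.
From mathcomp Require Import all_classical all_reals all_analysis.
Import Order.TTheory GRing.Theory Num.Theory.
Import numFieldNormedType.Exports.
Set Implicit Arguments.
Unset Strict Implicit.
Unset Printing Implicit Defensive.
Local Open Scope classical_set_scope.
Local Open Scope ring_scope.

Definition I0 (R : realType) : set R := `]0, 1].

(* A net indexed by I0 is encoded as a total function R -> R, whose values
   outside I0 are irrelevant; "for e small" is "\forall e \near 0^'+".  *)
Record gauge (R : realType) := Gauge {
  gauge_fun :> R -> R ;
  gauge_cvg : gauge_fun @ 0^'+ --> 0^'+ }.

Definition moderate_net (R : realType) (rho : gauge R) (x : R -> R) : Prop :=
  exists2 N : R, 0 < N & x =O_ (0^'+) (fun e => rho e `^ (- N)).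

Definition negligible_net (R : realType) (rho : gauge R) (x : R -> R) : Prop :=
  forall N : R, 0 < N -> x =O_ (0^'+) (fun e => rho e `^ N).

Definition moderate (R : realType) (rho : gauge R) : {pred R -> R} :=
  [pred x : R -> R | `[< moderate_net rho x >]].

Section Moderate.
Variables (R : realType) (rho : gauge R).
Implicit Types x y : R -> R.

Lemma gauge_gt0 : \forall e \near 0^'+, 0 < rho e.
Proof. exact: (@gauge_cvg R rho _ (@nbhs_right_gt R 0)). Qed.

Lemma gauge_lt (c : R) : 0 < c -> \forall e \near 0^'+, rho e < c.
Proof. by move=> /(@nbhs_right_lt R 0 c); exact: (@gauge_cvg R rho). Qed.

Lemma bigOgaugeP x (N : R) :
  x =O_ (0^'+) (fun e => rho e `^ N) <->
  exists2 C : R, 0 < C & \forall e \near 0^'+, `|x e| <= C * rho e `^ N.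
Proof.
split=> [/eqO_exP[C C0 h]|[C C0 h]].
  exists C => //; near=> e.
  by rewrite -[X in _ * X](ger0_norm (powR_ge0 _ _)); near: e.
apply/eqO_exP; exists C => //; near=> e.
by rewrite (ger0_norm (powR_ge0 _ _)); near: e.
Unshelve. all: by end_near. Qed.

Lemma bigO_gauge_le x (M N : R) : N <= M ->
  x =O_ (0^'+) (fun e => rho e `^ M) -> x =O_ (0^'+) (fun e => rho e `^ N).
Proof.
move=> NM /bigOgaugeP[C C0 h]; apply/bigOgaugeP; exists C => //; near=> e.
apply: (@le_trans _ _ (C * rho e `^ M)); first by near: e.
have rho01 : 0 < rho e <= 1.
  apply/andP; split; first by near: e; exact: gauge_gt0.
  by apply: ltW; near: e; exact: gauge_lt.
by rewrite ler_wpM2l ?(ltW C0)// (ger_powR rho01 NM).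
Unshelve. all: by end_near. Qed.

Lemma bigO_gaugeB x y (N : R) :
  x =O_ (0^'+) (fun e => rho e `^ N) -> y =O_ (0^'+) (fun e => rho e `^ N) ->
  (x - y) =O_ (0^'+) (fun e => rho e `^ N).
Proof.
move=> /bigOgaugeP[C C0 hx] /bigOgaugeP[D D0 hy]; apply/bigOgaugeP.
exists (C + D); first exact: addr_gt0.
near=> e; rewrite mulrDl (le_trans (ler_normB _ _))// lerD//; first by near: e.
by near: e.
Unshelve. all: by end_near. Qed.

Lemma bigO_gaugeM x y (M N : R) :
  x =O_ (0^'+) (fun e => rho e `^ M) -> y =O_ (0^'+) (fun e => rho e `^ N) ->
  (x * y) =O_ (0^'+) (fun e => rho e `^ (M + N)).
Proof.
move=> /bigOgaugeP[C C0 hx] /bigOgaugeP[D D0 hy]; apply/bigOgaugeP.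
exists (C * D); first exact: mulr_gt0.
near=> e; rewrite powRD; last first.
  by apply/implyP => _; rewrite gt_eqF//; near: e; exact: gauge_gt0.
rewrite mulrACA normrM ler_pM//; first by near: e.
by near: e.
Unshelve. all: by end_near. Qed.

Fact moderate_subring : subring_closed (moderate rho).
Proof.
split.
- apply/asboolP; exists 1 => //; apply: (@bigO_gauge_le _ 0) => //.
  apply/bigOgaugeP; exists 1 => //; near=> e.
  by rewrite powRr0 mulr1 normr1.
- move=> x y /asboolP[M M0 hx] /asboolP[N N0 hy]; apply/asboolP.
  exists (M + N); first exact: addr_gt0.
  apply: bigO_gaugeB.
    by apply: bigO_gauge_le hx; rewrite lerN2 lerDl ltW.
  by apply: bigO_gauge_le hy; rewrite lerN2 lerDr ltW.
- move=> x y /asboolP[M M0 hx] /asboolP[N N0 hy]; apply/asboolP.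
  exists (M + N); first exact: addr_gt0.
  by rewrite opprD; exact: bigO_gaugeM.
Unshelve. all: by end_near. Qed.

HB.instance Definition _ :=
  GRing.isSubringClosed.Build (R -> R) (moderate rho) moderate_subring.

Record mnet := MNet { mnet_fun :> R -> R ; _ : mnet_fun \in moderate rho }.

HB.instance Definition _ := [isSub for mnet_fun].
HB.instance Definition _ := [Choice of mnet by <:].
HB.instance Definition _ := [SubChoice_isSubComNzRing of mnet by <:].

Definition negligible_mnet : {pred mnet} :=
  [pred x : mnet | `[< negligible_net rho x >]].

Fact negligible_ideal : idealr_closed negligible_mnet.
Proof.
split.
- apply/asboolP => N N0; apply/bigOgaugeP; exists 1 => //; near=> e.
  by rewrite normr0 mul1r powR_ge0.
- apply/asboolP => /(_ 1 ltr01) /bigOgaugeP[C C0 h].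
  have [e [/= h1 h2 h3]] : exists e, [/\ `|1 : R| <= C * rho e `^ 1,
      0 < rho e & rho e < C^-1].
    apply: (@filter_ex _ (0^'+ : set_system R)).
    near=> e; split; near: e; [exact: h|exact: gauge_gt0|].
    by apply: gauge_lt; rewrite invr_gt0.
  move: h1; rewrite normr1 powRr1 ?(ltW h2)// leNgt -ltr_pdivlMl// mulr1.
  by rewrite h3.
- move=> a x y /asboolP hx /asboolP hy; apply/asboolP => N N0.
  have /asboolP[M M0 ha] := valP a.
  have -> : (a * x + y : mnet) = (a * x - (- y)) by rewrite opprK.
  apply: bigO_gaugeB.
    rewrite -(addKr M N); apply: bigO_gaugeM ha _.
    by apply: hx; exact: addr_gt0.
  have /bigOgaugeP[C C0 h] := hy _ N0.
  by apply/bigOgaugeP; exists C => //; near=> e; rewrite normrN; near: e.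
Unshelve. all: by end_near. Qed.

HB.instance Definition _ :=
  isIdealr.Build mnet negligible_mnet negligible_ideal.

Definition gnum := {ideal_quot negligible_mnet}.

End Moderate.

Definition represents (R : realType) (rho : gauge R) (u : R -> R)
    (x : gnum rho) : Prop :=
  exists2 m : mnet rho, u = m & x = \pi_(gnum rho)%qT m.

Section GeneralizedNumbers.
Variables (R : realType) (rho : gauge R).
Implicit Types (x y a b : gnum rho) (X Y : set (gnum rho)).
Implicit Types f : gnum rho -> gnum rho.

Definition gle x y : Prop := exists u v : R -> R,
  [/\ represents u x, represents v y & forall e, I0 e -> u e <= v e].

Definition ginvertible x : Prop := exists y, x * y = 1.

Definition glt x y : Prop := gle 0 (y - x) /\ ginvertible (y - x).

Definition gitv a b : set (gnum rho) := [set x | gle a x /\ gle x b].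

Definition gnet_set (Om : R -> set R) : set (gnum rho) :=
  [set x | forall u, represents u x -> \forall e \near 0^'+, Om e (u e)].

(* Only used on open sets U; the values of g outside U do not matter then. *)
Definition smooth_on (U : set R) (g : R -> R) : Prop :=
  forall (n : nat) (t : R), U t -> derivable (derive1n n g) t 1.

Definition gsf_net X f (Om : R -> set R) (F : R -> R -> R) : Prop :=
  [/\ forall e, I0 e -> open (Om e) /\ smooth_on (Om e) (F e),
      X `<=` gnet_set Om,
      forall x u, X x -> represents u x ->
        represents (fun e => F e (u e)) (f x) &
      forall x u (n : nat), X x -> represents u x ->
        moderate_net rho (fun e => derive1n n (F e) (u e))].

(* A map X -> Y is encoded as a total function, considered on X only. *)
Definition GC X Y : set (gnum rho -> gnum rho) :=
  [set f | set_fun X Y f /\ exists Om F, gsf_net X f Om F].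

Definition GC0 a b : set (gnum rho -> gnum rho) :=
  [set eta | [/\ GC setT setT eta, eta a = 0 & eta b = 0]].

Definition oriented_integral (g : R -> R) (s t : R) : R :=
  if s <= t then \int[lebesgue_measure]_(r in `[s, t]) g r
  else - \int[lebesgue_measure]_(r in `[t, s]) g r.

(* The defining equation v = [\int_(u_e)^(w_e) F_e], taken as a relation: for
   a < b, the class v does not depend on the chosen F, u and w. *)
Definition is_gint f a b (v : gnum rho) : Prop :=
  exists Om F u w, [/\ gsf_net (gitv a b) f Om F, represents u a,
    represents w b &
    represents (fun e => oriented_integral (F e) (u e) (w e)) v].

End GeneralizedNumbers.

(* Main.v *)
Require Import Defs.
From mathcomp Require Import all_boot all_order all_algebra.
From mathcomp Require Import all_classical all_reals all_analysis.
From mathcomp Require Import ring lra zify.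
Import Order.TTheory GRing.Theory Num.Theory.
Import numFieldNormedType.Exports.
Local Open Scope classical_set_scope.
Local Open Scope ring_scope.

(* For points al <= xi <= be representing a <= x <= b, we show that the values
   F_e(xi_e) of a net F of f are negligible.  Some power delta of rho is so
   small that, if |F_e(xi_e)| > rho_e^N, then F_e keeps its sign and stays away
   from 0 on a subinterval of [al_e, be_e] of length delta_e, centred at some
   c_e, having xi_e as an endpoint.  Test f against the rational functions
     ((t - al_e)(t - be_e))^2 / (1 + (s_e (t - c_e))^2)^m,
   which are nonnegative and defined on all generalized numbers, so that no
   compactly supported bump is needed: with s_e a large enough power of 1/rho_e,
   the part of the integral outside the subinterval is O(rho^(2m - C)), while the
   part near c_e is at least rho^(m + C'), with C and C' independent of m.
   Hence a large m contradicts the vanishing of the integral. *)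

(** * Moderate and negligible nets in natural powers; calculus of representatives *)

Section Nets.
Set Implicit Arguments.
Unset Strict Implicit.
Context {R : realType} {rho : gauge R}.
Implicit Types (u v w : R -> R) (x y a b : gnum rho).

Lemma gauge_itv01 : \forall e \near 0^'+, 0 < rho e <= 1.
Proof.
near=> e; apply/andP; split; first by near: e; exact: gauge_gt0.
by rewrite ltW//; near: e; exact: gauge_lt.
Unshelve. all: by end_near. Qed.

(** As [rho] tends to 0, one further factor [(rho e)^-1] absorbs the constant of the big O, and real
    exponents round up. Every later estimate thus compares natural powers of [rho e], without
    constants. *)
Lemma moderate_netP u : moderate_net rho u <->
  exists k : nat, \forall e \near 0^'+, `|u e| <= (rho e)^-1 ^+ k.
Proof.
split=> [[N N0 /bigOgaugeP[C C0 h]]|[k h]].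
  exists (Num.bound N).+1; near=> e.
  have r0 : 0 < rho e by near: e; exact: gauge_gt0.
  apply: (@le_trans _ _ (C * rho e `^ (- N))); first by near: e.
  rewrite exprS ler_pM ?powR_ge0 ?(ltW C0)//.
    rewrite -[leLHS]invrK lef_pV2 ?posrE ?invr_gt0//.
    by rewrite ltW//; near: e; apply: gauge_lt; rewrite invr_gt0.
  rewrite exprVn -powR_mulrn ?(ltW r0)// -powRN.
  apply: ger_powR; first by near: e; exact: gauge_itv01.
  by rewrite lerN2 ltW// archi_boundP// ltW.
exists k.+1%:R; first by rewrite ltr0n.
apply/bigOgaugeP; exists 1 => //; near=> e.
have r0 : 0 < rho e by near: e; exact: gauge_gt0.
apply: (@le_trans _ _ ((rho e)^-1 ^+ k)); first by near: e.
rewrite mul1r powRN powR_mulrn ?(ltW r0)// -exprVn.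
apply: ler_weXn2l; last exact: leqnSn.
by rewrite invf_ge1//; near: e; apply: filterS gauge_itv01 => e' /andP[].
Unshelve. all: by end_near. Qed.

Lemma negligible_netP u : negligible_net rho u <->
  forall k : nat, \forall e \near 0^'+, `|u e| <= rho e ^+ k.
Proof.
split=> [h k|h N N0].
  have /bigOgaugeP[C C0 {}h] := h k.+1%:R (ltr0Sn _ _); near=> e.
  have r0 : 0 < rho e by near: e; exact: gauge_gt0.
  apply: (@le_trans _ _ (C * rho e `^ k.+1%:R)); first by near: e.
  rewrite powR_mulrn ?(ltW r0)// exprS mulrA ler_piMl ?exprn_ge0 ?(ltW r0)//.
  rewrite -ler_pdivlMl// mulr1 ltW//; near: e; apply: gauge_lt.
  by rewrite invr_gt0.
apply/bigOgaugeP; exists 1 => //; near=> e.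
have r0 : 0 < rho e by near: e; exact: gauge_gt0.
apply: (@le_trans _ _ (rho e ^+ Num.bound N)); first by near: e; exact: h.
rewrite mul1r -powR_mulrn ?(ltW r0)//.
apply: ger_powR; first by near: e; exact: gauge_itv01.
by rewrite ltW// archi_boundP// ltW.
Unshelve. all: by end_near. Qed.

Lemma represents_moderate u x : represents u x -> moderate_net rho u.
Proof. by move=> [m -> _]; have /asboolP := valP m. Qed.

Lemma moderate_represents u : moderate_net rho u -> exists x, represents u x.
Proof.
move=> h; have hu : u \in moderate rho by apply/asboolP.
by exists (\pi_(gnum rho)%qT (MNet hu)); exists (MNet hu).
Qed.

Lemma represents_exists x : exists u, represents u x.
Proof. by exists (repr x : mnet rho); exists (repr x); rewrite ?reprK. Qed.

Lemma represents_inj u x y : represents u x -> represents u y -> x = y.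
Proof.
move=> [m um ->] [n un ->].
by have -> : m = n by apply: val_inj; rewrite /= -um un.
Qed.

Lemma represents_negligible u v x : represents u x -> represents v x ->
  negligible_net rho (u - v).
Proof.
move=> [m -> ->] [n -> /eqP]; rewrite -Quotient.idealrBE => /asboolP.
by [].
Qed.

Lemma negligible_represents u v x : represents u x ->
  negligible_net rho (u - v) -> represents v x.
Proof.
move=> [m um ->] uv.
have hv : v \in moderate rho.
  rewrite -[v](subKr u); apply: rpredB; first by rewrite um; exact: valP.
  apply/asboolP; exists 1 => //; apply: bigO_gauge_le (uv 1 ltr01).
  by rewrite lerNl (le_trans _ ler01)// lerN10.
exists (MNet hv) => //.
by apply/eqP; rewrite -Quotient.idealrBE; apply/asboolP; move: uv; rewrite um.
Qed.

Lemma representsD u v x y : represents u x -> represents v y ->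
  represents (u + v) (x + y).
Proof.
by move=> [m -> ->] [n -> ->]; exists (m + n); rewrite // rmorphD.
Qed.

Lemma representsN u x : represents u x -> represents (- u) (- x).
Proof. by move=> [m -> ->]; exists (- m); rewrite // rmorphN. Qed.

Lemma representsM u v x y : represents u x -> represents v y ->
  represents (u * v) (x * y).
Proof. by move=> [m -> ->] [n -> ->]; exists (m * n); rewrite // rmorphM. Qed.

Lemma representsB u v x y : represents u x -> represents v y ->
  represents (u - v) (x - y).
Proof. by move=> hu hv; apply: representsD => //; exact: representsN. Qed.

Lemma represents0 : represents (0 : R -> R) (0 : gnum rho).
Proof. by exists 0; rewrite // rmorph0. Qed.

Lemma represents1 : represents (1 : R -> R) (1 : gnum rho).
Proof. by exists 1; rewrite // rmorph1. Qed.

Lemma represents_near u v x : represents u x ->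
  (forall k : nat, \forall e \near 0^'+, `|u e - v e| <= rho e ^+ k) ->
  represents v x.
Proof. by move=> ux h; apply: negligible_represents ux _; apply/negligible_netP. Qed.

Lemma represents_close u v x (k : nat) : represents u x -> represents v x ->
  \forall e \near 0^'+, `|u e - v e| <= rho e ^+ k.
Proof.
move=> ux vx; have /negligible_netP := represents_negligible ux vx; exact.
Qed.

Lemma represents_bound u x : represents u x ->
  exists k : nat, \forall e \near 0^'+, `|u e| <= (rho e)^-1 ^+ k.
Proof. by move=> /represents_moderate/moderate_netP. Qed.

End Nets.

(** * From generalized points to uniform bounds on real segments *)

Section Intervals.
Set Implicit Arguments.
Unset Strict Implicit.
Context {R : realType} {rho : gauge R}.
Implicit Types (u v w s t : R -> R) (x y a b : gnum rho).

Lemma near_I0 : \forall e \near 0^'+, I0 (e : R).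
Proof.
near=> e; rewrite /I0 /= in_itv/=; apply/andP; split.
  by near: e; exact: nbhs_right_gt.
by near: e; exact: nbhs_right_le.
Unshelve. all: by end_near. Qed.

Lemma near_choice (Q : R -> R -> Prop) :
  (\forall e \near 0^'+, exists r, Q e r) ->
  exists t : R -> R, \forall e \near 0^'+, Q e (t e).
Proof.
move=> h; exists (fun e => xget 0 [set r | Q e r]).
by apply: filterS h => e [r Qr]; exact: (xgetPex 0 (ex_intro _ r Qr)).
Qed.

Lemma moderate_net_le u v : moderate_net rho u ->
  (\forall e \near 0^'+, `|v e| <= `|u e|) -> moderate_net rho v.
Proof.
move=> /moderate_netP[k uk] vu; apply/moderate_netP; exists k.
by near=> e; apply: (@le_trans _ _ `|u e|); near: e.
Unshelve. all: by end_near. Qed.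

Lemma moderate_net_itv u v t : moderate_net rho u -> moderate_net rho v ->
  (\forall e \near 0^'+, u e <= t e <= v e) -> moderate_net rho t.
Proof.
move=> mu mv h.
have norm_mod w : moderate_net rho w -> (fun e => `|w e|) \in moderate rho.
  move=> mw; apply/asboolP; apply: moderate_net_le mw _.
  by near=> e; rewrite normr_id.
have /asboolP : (fun e => `|u e|) + (fun e => `|v e|) \in moderate rho.
  by rewrite rpredD ?norm_mod.
move=> /moderate_net_le; apply; near=> e.
have /andP[h1 h2] : u e <= t e <= v e by near: e.
rewrite fctE [leRHS]ger0_norm ?addr_ge0// ler_norml; apply/andP; split.
- rewrite (le_trans _ h1)// lerNl (le_trans (ler_norm _))// normrN.
  by rewrite lerDl.
- by rewrite (le_trans h2)// (le_trans (ler_norm _))// lerDr.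
Unshelve. all: by end_near. Qed.

Lemma near_gle u v x y : represents u x -> represents v y ->
  (\forall e \near 0^'+, u e <= v e) -> gle x y.
Proof.
(* [gle] asks for the inequality at every index of [I0]; the maximum grants it there and agrees with
   [v] for small [e]. *)
move=> ux vy uv; exists u, (fun e => Num.max (u e) (v e)); split => //.
  apply: represents_near vy _ => k; near=> e.
  rewrite max_r ?subrr ?normr0 ?exprn_ge0//.
    by rewrite ltW//; near: e; exact: gauge_gt0.
  by near: e.
by move=> e _; rewrite le_max lexx.
Unshelve. all: by end_near. Qed.

Lemma gitv_net a b u v t : represents u a -> represents v b ->
  (\forall e \near 0^'+, u e <= t e <= v e) ->
  exists2 y, gitv a b y & represents t y.
Proof.
move=> ua vb h; have [|y ty] := @moderate_represents _ rho t.
  exact: moderate_net_itv (represents_moderate ua) (represents_moderate vb) h.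
exists y => //; split.
  by apply: (near_gle ua ty); apply: filterS h => e /andP[].
by apply: (near_gle ty vb); apply: filterS h => e /andP[].
Qed.

(* A property holding along every generalized point of [a, b] holds uniformly:
   otherwise counterexamples, one for each e, make up a generalized point. *)
Lemma near_itv a b u v (P : R -> R -> Prop) :
  represents u a -> represents v b -> (\forall e \near 0^'+, u e <= v e) ->
  (forall y t, gitv a b y -> represents t y ->
     \forall e \near 0^'+, P e (t e)) ->
  \forall e \near 0^'+, forall r, u e <= r <= v e -> P e r.
Proof.
move=> ua vb uv h.
pose bad e := [set r | u e <= r <= v e /\ ~ P e r].
(* The default [u e] keeps the net inside the segment at indices without a counterexample. *)
have [|y aby ty] := @gitv_net _ _ _ _ (fun e => xget (u e) (bad e)) ua vb.
  apply: filterS uv => e uve.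
  by case: xgetP => [r _ []|_]//; rewrite lexx.
apply: filterS (h _ _ aby ty) => e Pe r ur; apply: contrapT => nPr.
by have [] := xgetPex (u e) (ex_intro (bad e) r (conj ur nPr)).
Qed.

Variables (a b : gnum rho) (f : gnum rho -> gnum rho).
Variables (Om : R -> set R) (F : R -> R -> R).
Hypothesis fF : gsf_net (gitv a b) f Om F.
Variables u v : R -> R.
Hypotheses (ua : represents u a) (vb : represents v b).
Hypothesis uv : \forall e \near 0^'+, u e <= v e.

(** Smoothness is known on [Om e] only. Every generalized point of [a, b] lies in [gnet_set Om], so
    [near_itv] puts the whole real segment inside [Om e]. *)
Lemma gsf_net_derivable : \forall e \near 0^'+, forall n r, u e <= r <= v e ->
  derivable (derive1n n (F e)) r 1.
Proof.
case: fF => smF abOm _ _; near=> e.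
have : forall r, u e <= r <= v e -> Om e r.
  near: e; apply: (near_itv ua vb uv) => y t aby ty.
  exact: (abOm _ aby).
have /smF[_ sm] : I0 e by near: e; exact: near_I0.
by move=> h n r /h; exact: sm.
Unshelve. all: by end_near. Qed.

(** Moderateness is given point by point. Points where the absolute value of the derivative is
    largest form a generalized point of [a, b], and the bound there serves the whole segment. *)
Lemma gsf_net_bound n : exists k : nat, \forall e \near 0^'+,
  forall r, u e <= r <= v e -> `|derive1n n (F e) r| <= (rho e)^-1 ^+ k.
Proof.
have [|t ht] := @near_choice (fun e c => u e <= c <= v e /\
    forall r, u e <= r <= v e -> `|derive1n n (F e) r| <= `|derive1n n (F e) c|).
  near=> e.
  have uve : u e <= v e by near: e.
  have [|c c1 c2] := @EVT_max R (fun r => `|derive1n n (F e) r|) _ _ uve.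
    have : {within `[u e, v e], continuous (derive1n n (F e))}.
      apply: derivable_within_continuous => r; rewrite in_itv/= => ur.
      by move: r ur; near: e; apply: filterS gsf_net_derivable => e h r; exact: h.
    by move=> h r; apply: continuous_comp; [exact: h|exact: norm_continuous].
  by exists c; split=> // r ur; apply: c2; rewrite in_itv.
have [|y aby ty] := @gitv_net _ _ _ _ t ua vb.
  by apply: filterS ht => e [].
case: fF => _ _ _ /(_ _ _ n aby ty)/moderate_netP[k hk]; exists k.
near=> e => r ur; apply: (@le_trans _ _ `|derive1n n (F e) (t e)|).
  by move: r ur; near: e; apply: filterS ht => e [].
by near: e.
Unshelve. all: by end_near. Qed.

End Intervals.

(** * Rational test functions as generalized smooth functions *)

Section RationalNets.
Set Implicit Arguments.
Unset Strict Implicit.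
Context {R : realType} (rho : gauge R).
Implicit Types (u s c : R -> R) (x y : gnum rho) (F : R -> R -> R).

(* Closed under derivation, and acting on generalized numbers: this is what
   makes these nets generalized smooth functions. *)
Inductive rational_net : (R -> R -> R) -> Prop :=
| rational_net_cst u of moderate_net rho u : rational_net (fun e _ => u e)
| rational_net_id : rational_net (fun _ r => r)
| rational_netD F G of rational_net F & rational_net G :
    rational_net (fun e r => F e r + G e r)
| rational_netM F G of rational_net F & rational_net G :
    rational_net (fun e r => F e r * G e r)
| rational_net_bell s c of moderate_net rho s & moderate_net rho c :
    rational_net (fun e r => (1 + (s e * (r - c e)) ^+ 2)^-1).

Lemma bell_denom_gt0 (z : R) : 0 < 1 + z ^+ 2.
Proof. by rewrite ltr_pwDl ?sqr_ge0. Qed.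

Lemma moderate_netM u v : moderate_net rho u -> moderate_net rho v ->
  moderate_net rho (u * v).
Proof.
by move=> mu mv; have /asboolP := rpredM (asboolT mu : u \in moderate rho)
  (asboolT mv : v \in moderate rho).
Qed.

Lemma moderate_net_cst (r : R) : moderate_net rho (fun=> r).
Proof.
apply/moderate_netP; exists 1%N; near=> e.
have r0 : 0 < rho e by near: e; exact: gauge_gt0.
have d0 : 0 < `|r| + 1 by rewrite ltr_wpDl.
rewrite expr1 (@le_trans _ _ (`|r| + 1)) ?lerDl//.
rewrite -[leLHS]invrK lef_pV2 ?posrE ?invr_gt0// ltW//.
by near: e; apply: gauge_lt; rewrite invr_gt0.
Unshelve. all: by end_near. Qed.

Lemma moderate_netN u : moderate_net rho u -> moderate_net rho (- u).
Proof.
by move=> mu; have /asboolP := rpredNr (asboolT mu : u \in moderate rho).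
Qed.

Lemma rational_net_derive F : rational_net F ->
  exists2 F', rational_net F' & forall e r, is_derive r (1 : R) (F e) (F' e r).
Proof.
elim=> [u mu||{}F G nF [F' nF' dF] nG [G' nG' dG]|
        {}F G nF [F' nF' dF] nG [G' nG' dG]|s c ms mc].
- exists (fun _ _ => 0) => [|e r]; last exact: is_derive_cst.
  exact: (rational_net_cst (moderate_net_cst 0)).
- exists (fun _ _ => 1) => [|e r]; last exact: is_derive_id.
  exact: (rational_net_cst (moderate_net_cst 1)).
- exists (fun e r => F' e r + G' e r) => [|e r]; last exact: is_deriveD.
  exact: rational_netD.
- exists (fun e r => F e r * G' e r + G e r * F' e r) => [|e r].
    by apply: rational_netD; exact: rational_netM.
  exact: is_deriveM.
- pose b e r := (1 + (s e * (r - c e)) ^+ 2)^-1.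
  (* With q the denominator, the derivative of 1/q is - q' / q^2, again a product of bells,
     constants and an affine factor. *)
  exists (fun e r => b e r * b e r * (- 2 * (s e * s e) * (r + - c e))).
    apply: rational_netM; first by apply: rational_netM; exact: rational_net_bell.
    apply: rational_netM.
      apply: (@rational_net_cst (fun e => - 2 * (s e * s e))).
      by apply: moderate_netM (moderate_net_cst _) _; exact: moderate_netM.
    apply: rational_netD; first exact: rational_net_id.
    by apply: (@rational_net_cst (fun e => - c e)); exact: moderate_netN.
  move=> e r.
  have dq : is_derive r (1 : R) (fun r => 1 + (s e * (r - c e)) ^+ 2)
      (2 * (s e * s e) * (r - c e)).
    have dl : is_derive r (1 : R) (fun r => r - c e) 1.
      by apply: is_derive_eq; rewrite subr0.
    have dm : is_derive r (1 : R) (fun r => s e * (r - c e)) (s e).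
      by apply: is_derive_eq; rewrite /GRing.scale /= mulr1.
    have ds : is_derive r (1 : R) (fun r => (s e * (r - c e)) ^+ 2)
        (2 * (s e * s e) * (r - c e)).
      by apply: is_derive_eq; rewrite /GRing.scale /=; ring.
    by apply: is_derive_eq; ring.
  have q0 := lt0r_neq0 (bell_denom_gt0 (s e * (r - c e))).
  have dV := @is_deriveV R (fun r => 1 + (s e * (r - c e)) ^+ 2) _ _ _ q0 dq.
  apply: (is_derive_eq dV).
  by rewrite /b /GRing.scale /=; field.
Qed.

Lemma rational_net_derive1n F n : rational_net F ->
  exists2 F', rational_net F' & forall e, derive1n n (F e) = F' e.
Proof.
move=> nF; elim: n => [|n [F' nF' dF]]; first by exists F.
have [F'' nF'' dF'] := rational_net_derive nF'; exists F'' => // e.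
rewrite derive1nS dF; apply/funext => r; rewrite derive1E.
exact: derive_val.
Qed.

Lemma moderate_net_bell s c u : moderate_net rho s -> moderate_net rho c ->
  moderate_net rho u ->
  moderate_net rho (fun e => (1 + (s e * (u e - c e)) ^+ 2)^-1).
Proof.
move=> ms mc mu; apply: moderate_net_le (moderate_net_cst 1) _.
near=> e; rewrite normr1 ger0_norm; last by rewrite invr_ge0 ltW ?bell_denom_gt0.
by rewrite invf_le1 ?bell_denom_gt0// lerDl sqr_ge0.
Unshelve. all: by end_near. Qed.

(** Sums and products descend to classes. For a bell, the denominator is at least 1, so its inverse
    is moderate and the class [q x] is invertible; uniqueness of inverses makes the value
    independent of the representative. *)
Lemma rational_net_represents F : rational_net F ->
  exists eta : gnum rho -> gnum rho, forall u x, represents u x ->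
    represents (fun e => F e (u e)) (eta x).
Proof.
elim=> [u mu||{}F G nF [f hF] nG [g hG]|
        {}F G nF [f hF] nG [g hG]|s c ms mc].
- by have [y uy] := moderate_represents mu; exists (fun=> y).
- by exists id.
- by exists (fun x => f x + g x) => u x ux; apply: representsD; auto.
- by exists (fun x => f x * g x) => u x ux; apply: representsM; auto.
- have [S sS] := moderate_represents ms; have [C cC] := moderate_represents mc.
  pose q x := 1 + (S * (x - C)) * (S * (x - C)).
  have hq u x : represents u x ->
      represents (fun e => 1 + (s e * (u e - c e)) ^+ 2) (q x).
    move=> ux; apply: representsD; first exact: represents1.
    by apply: representsM; apply: representsM => //; apply: representsB.
  have inv_ex u x : represents u x -> exists2 y,
      represents (fun e => (1 + (s e * (u e - c e)) ^+ 2)^-1) y & y * q x = 1.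
    move=> ux.
    have [y uy] := moderate_represents (moderate_net_bell ms mc (represents_moderate ux)).
    exists y => //; apply: represents_inj (representsM uy (hq _ _ ux)) _.
    rewrite (_ : _ * _ = 1); first exact: represents1.
    by apply/funext => e; rewrite !fctE mulVf// gt_eqF// bell_denom_gt0.
  have ex x : exists y, y * q x = 1.
    by have [u ux] := represents_exists x; have [y _ yq] := inv_ex _ _ ux; exists y.
  have [g gq] := choice ex; exists g => u x ux.
  have [y uy yq] := inv_ex _ _ ux.
  suff -> : g x = y by [].
  by rewrite -[LHS]mulr1 -yq mulrCA gq mulr1.
Qed.

(** Each derivative is again a rational net, hence represents a generalized number at every point;
    this is the required moderateness. *)
Lemma rational_net_GC F : rational_net F ->
  exists2 eta : gnum rho -> gnum rho, GC setT setT eta &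
    forall u x, represents u x -> represents (fun e => F e (u e)) (eta x).
Proof.
move=> nF; have [eta h] := rational_net_represents nF; exists eta => //.
split=> //; exists (fun=> setT), F; split => //.
- move=> e _; split; first exact: openT.
  move=> n r _; have [F' /rational_net_derive[F'' _ d] ->] := rational_net_derive1n n nF.
  exact: ex_derive.
- by move=> x _ u _; near=> e.
- by move=> x u _; exact: h.
- move=> x u n _ ux; have [F' nF' dF] := rational_net_derive1n n nF.
  have [g hg] := rational_net_represents nF'.
  have := represents_moderate (hg _ _ ux); congr moderate_net.
  by apply/funext => e; rewrite dF.
Unshelve. all: by end_near. Qed.

End RationalNets.

(** * Integral and Lipschitz estimates on real segments *)

Section RealEstimates.
Set Implicit Arguments.
Unset Strict Implicit.
Context {R : realType}.
Notation mu := (@lebesgue_measure R).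
Implicit Types (h : R -> R) (u v p q k : R).

Lemma integrable_segment h u v : {within `[u, v], continuous h} ->
  mu.-integrable `[u, v] (EFin \o h).
Proof.
move=> ch; apply: continuous_compact_integrable => //.
exact: segment_compact.
Qed.

Lemma Rintegral_segment_ge h u v k : u <= v -> {within `[u, v], continuous h} ->
  (forall r, u <= r <= v -> k <= h r) ->
  k * (v - u) <= \int[mu]_(r in `[u, v]) h r.
Proof.
move=> uv ch kh.
have -> : k * (v - u) = \int[mu]_(r in `[u, v]) k.
  rewrite Rintegral_cst//= lebesgue_measure_itv/= lte_fin.
  by move: uv; rewrite le_eqVlt => /predU1P[->|->//]; rewrite ltxx subrr.
apply: le_Rintegral => //.
- by apply: integrable_segment => r; exact: cvg_cst.
- exact: integrable_segment.
Qed.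

Lemma Rintegral_segment_cat h u p v : u <= p -> p <= v ->
  {within `[u, v], continuous h} ->
  \int[mu]_(r in `[u, v]) h r =
  \int[mu]_(r in `[u, p]) h r + \int[mu]_(r in `[p, v]) h r.
Proof.
move=> up pv ch; have ih := integrable_segment ch.
have := @Rintegral_itvB R h (BLeft u) (BRight v) p ih.
rewrite !bnd_simp => /(_ up pv); rewrite Rintegral_itv_obnd_cbnd.
  by move=> <-; rewrite addrC subrK.
apply: integrableS ih => //.
by move=> r /=; rewrite !in_itv/= => /andP[pr ->]; rewrite (le_trans up (ltW pr)).
Qed.

(** The integral is split at [p] and [q]. Since [B] is nonnegative, the loss may be charged to
    [p, q] as well, so that only the total length enters. *)
Lemma Rintegral_bump_ge h u p q v A B : u <= p -> p <= q -> q <= v -> 0 <= B ->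
  {within `[u, v], continuous h} ->
  (forall r, p <= r <= q -> A <= h r) ->
  (forall r, u <= r <= v -> - B <= h r) ->
  A * (q - p) - B * (v - u) <= \int[mu]_(r in `[u, v]) h r.
Proof.
move=> up pq qv B0 ch hA hB.
have sub x y : u <= x -> y <= v -> {within `[x, y], continuous h}.
  move=> ux yv; apply: continuous_subspaceW ch => r /=.
  by rewrite !in_itv/= => /andP[xr ry]; rewrite (le_trans ux xr) (le_trans ry yv).
have pv := le_trans pq qv; have uq := le_trans up pq.
rewrite (Rintegral_segment_cat up pv ch).
rewrite (Rintegral_segment_cat pq qv (sub _ _ up (lexx _))).
have h1 : - B * (p - u) <= \int[mu]_(r in `[u, p]) h r.
  apply: Rintegral_segment_ge (sub _ _ _ _) _ => // r /andP[ur rp].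
  by apply: hB; rewrite ur (le_trans rp).
have h2 : A * (q - p) <= \int[mu]_(r in `[p, q]) h r.
  exact: Rintegral_segment_ge (sub _ _ _ _) _.
have h3 : - B * (v - q) <= \int[mu]_(r in `[q, v]) h r.
  apply: Rintegral_segment_ge (sub _ _ _ _) _ => // r /andP[qr rv].
  by apply: hB; rewrite rv (le_trans uq).
have : 0 <= B * (q - p) by rewrite mulr_ge0// subr_ge0.
lra.
Qed.

Lemma lipschitz_segment h u v (K : R) :
  (forall r, u <= r <= v -> derivable h r 1) ->
  (forall r, u <= r <= v -> `|derive1 h r| <= K) ->
  forall r s, u <= r <= v -> u <= s <= v -> `|h r - h s| <= K * `|r - s|.
Proof.
move=> dh hK.
suff H r s : u <= r -> r <= s -> s <= v -> `|h s - h r| <= K * `|s - r|.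
  move=> r s /andP[ur rv] /andP[us sv]; have [rs|sr] := leP r s.
    by rewrite distrC (distrC r); exact: H.
  by apply: H => //; exact: ltW.
move=> ur rs sv.
have i x : r <= x <= s -> u <= x <= v.
  by move=> /andP[rx xs]; rewrite (le_trans ur rx) (le_trans xs sv).
have [|||c crs ->] := @MVT_segment R h (derive1 h) r s.
- exact: rs.
- move=> x; rewrite in_itv/= => /andP[rx xs].
  by rewrite derive1E; apply: derivableP; apply: dh; apply: i; rewrite !ltW.
- apply: derivable_within_continuous => x; rewrite in_itv/= => rxs.
  by apply: dh; exact: i.
by rewrite normrM ler_wpM2r// hK// i//; move: crs; rewrite in_itv.
Qed.

End RealEstimates.

(** * Pointwise bounds for the test function *)

Section Bump.
Set Implicit Arguments.
Unset Strict Implicit.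
Context {R : realType}.
Implicit Types (al be s c d t p : R) (m : nat).

(** The square provides the zeros at [al] and [be] while keeping the sign beyond them, where an
    integral between other representatives of a and b may reach. *)
Definition bell_bump al be s c m t :=
  ((t - al) * (t - be)) ^+ 2 * (1 + (s * (t - c)) ^+ 2)^-1 ^+ m.

Lemma bell_bump_ge0 al be s c m t : 0 <= bell_bump al be s c m t.
Proof.
by rewrite mulr_ge0 ?sqr_ge0// exprn_ge0// invr_ge0 ltW ?bell_denom_gt0.
Qed.

(** Both linear factors have size at least [d], and the denominator of the bell is at most 2. *)
Lemma bell_bump_core_ge al be s c m t d : 0 <= d -> d <= t - al -> d <= be - t ->
  `|s * (t - c)| <= 1 -> d ^+ 4 * 2^-1 ^+ m <= bell_bump al be s c m t.
Proof.
move=> d0 da db sc; apply: ler_pM; rewrite ?exprn_ge0//.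
- have -> : (t - al) * (t - be) = - ((t - al) * (be - t)) by ring.
  rewrite -[4%N]/(2 * 2)%N exprM sqrrN.
  have dd : d * d <= (t - al) * (be - t) by exact: ler_pM.
  have X0 : 0 <= (t - al) * (be - t) by apply: le_trans dd; rewrite mulr_ge0.
  by rewrite lerXn2r ?nnegrE ?sqr_ge0.
- rewrite lerXn2r ?nnegrE// ?invr_ge0 ?(ltW (bell_denom_gt0 _))//.
  rewrite lef_pV2 ?posrE ?bell_denom_gt0//.
  by rewrite -[2]/(1 + 1) lerD2l -real_normK ?num_real// expr_le1.
Qed.

Lemma bell_bump_tail_le al be s c m t D q : 0 < q ->
  `|t - al| <= D -> `|t - be| <= D -> q^-1 <= (s * (t - c)) ^+ 2 ->
  bell_bump al be s c m t <= D ^+ 4 * q ^+ m.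
Proof.
move=> q0 ta tb qs; have D0 : 0 <= D by exact: le_trans tb.
apply: ler_pM.
- exact: sqr_ge0.
- by rewrite exprn_ge0// invr_ge0 ltW ?bell_denom_gt0.
- rewrite -real_normK ?num_real// -[4%N]/(2 * 2)%N exprM lerXn2r ?nnegrE ?sqr_ge0//.
  by rewrite normrM expr2 ler_pM.
- rewrite lerXn2r ?nnegrE ?invr_ge0 ?(ltW (bell_denom_gt0 _)) ?(ltW q0)//.
  rewrite -[leRHS]invrK lef_pV2 ?posrE ?bell_denom_gt0 ?invr_gt0//.
  by rewrite (le_trans qs)// lerDr.
Qed.

Lemma exprVM p k j : p != 0 -> p^-1 ^+ k * p ^+ (k + j) = p ^+ j.
Proof. by move=> p0; rewrite exprD mulrA -exprMn mulVf// expr1n mul1r. Qed.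

End Bump.

(** * The order on generalized numbers, read on arbitrary representatives *)

Section Points.
Set Implicit Arguments.
Unset Strict Implicit.
Context {R : realType} {rho : gauge R}.
Implicit Types (u v w s t : R -> R) (x y a b : gnum rho).

(** The ordered representatives differ from [u] and [v] by at most [rho e ^+ k.+1] each, and two
    such errors fit into [rho e ^+ k]. *)
Lemma gle_near x y u v k : gle x y -> represents u x -> represents v y ->
  \forall e \near 0^'+, u e <= v e + rho e ^+ k.
Proof.
move=> [u' [v' [u'x v'y uv']]] ux vy; near=> e.
have r0 : 0 < rho e by near: e; exact: gauge_gt0.
have r1 : rho e < 1/2 by near: e; exact: gauge_lt.
have h : u' e <= v' e by apply: uv'; near: e; exact: near_I0.
have hu : `|u e - u' e| <= rho e ^+ k.+1 by near: e; exact: represents_close ux u'x.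
have hv : `|v' e - v e| <= rho e ^+ k.+1 by near: e; exact: represents_close v'y vy.
have rk := exprn_gt0 k r0; move: hu hv.
rewrite exprS !ler_norml => /andP[_ hu] /andP[_ hv].
have : rho e * rho e ^+ k <= 1/2 * rho e ^+ k by rewrite ler_pM2r// ltW.
lra.
Unshelve. all: by end_near. Qed.

(** If [w] represents the inverse of b - a and is at most [(rho e)^-1 ^+ k], then [v e - u e] has
    absolute value at least half of [rho e ^+ k]. It cannot be negative, as [gle] allows a deficit
    of only [rho e ^+ k.+2]. *)
Lemma glt_near a b u v : glt a b -> represents u a -> represents v b ->
  exists k : nat, \forall e \near 0^'+, rho e ^+ k <= v e - u e.
Proof.
move=> [le0 [y bay]] ua vb; have [w wy] := represents_exists y.
have [k wk] := represents_bound wy; exists k.+1.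
have d := representsB vb ua.
have hw : represents ((v - u) * w) (1 : gnum rho) by rewrite -bay; exact: representsM.
near=> e.
have r0 : 0 < rho e by near: e; exact: gauge_gt0.
have r1 : rho e < 1/2 by near: e; exact: gauge_lt.
have h0 : (0 : R) <= v e - u e + rho e ^+ k.+2.
  by near: e; exact: gle_near le0 represents0 d.
have h1 : `|(v e - u e) * w e - 1| <= rho e ^+ 1.
  by near: e; exact: represents_close hw represents1.
have h2 : `|w e| <= (rho e)^-1 ^+ k by near: e.
have rk := exprn_gt0 k r0.
have h3 : 2^-1 * rho e ^+ k <= `|v e - u e|.
  rewrite -ler_pdivlMr// -exprVn.
  apply: (@le_trans _ _ (`|v e - u e| * `|w e|)); last first.
    by rewrite ler_wpM2l.
  rewrite -normrM; move: h1; rewrite expr1 distrC => h1.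
  have := le_trans (lerB_dist _ _) h1; rewrite normr1; lra.
have h4 : rho e ^+ k.+1 <= 2^-1 * rho e ^+ k.
  by rewrite exprS ler_pM2r//; lra.
apply: (le_trans h4); have [//|neg] := leP 0 (v e - u e).
  by move=> pos; rewrite ger0_norm in h3.
rewrite (ltr0_norm neg) in h3; exfalso.
have : rho e ^+ k.+2 < 2^-1 * rho e ^+ k.
  rewrite exprS (le_lt_trans _ (_ : rho e ^+ k.+1 < _))//.
    by rewrite ler_piMl ?exprn_ge0 ?ltW//; lra.
  by rewrite exprS ltr_pM2r//; lra.
lra.
Unshelve. all: by end_near. Qed.

Lemma gitv_represents a b x : gitv a b x -> exists u t v,
  [/\ represents u a, represents t x, represents v b &
      \forall e \near 0^'+, u e <= t e <= v e].
Proof.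
move=> [[u [t [ua tx ut]]] [t' [v [t'x vb tv]]]].
(* The two inequalities come with different representatives of x; moving [v] by the negligible
   [t - t'] makes them share [t]. *)
exists u, t, (v + (t - t')); split => //.
  by have := representsD vb (representsB tx t'x); rewrite subrr addr0.
near=> e; have eI : I0 e by near: e; exact: near_I0.
rewrite ut//= !fctE; have := tv _ eI; lra.
Unshelve. all: by end_near. Qed.

(** The exponent precedes the representatives: the test function depends on it, whereas the
    endpoints of the integral are known only once the test function is fixed. *)
Lemma gsf_net_bound_uniform a b f Om F : glt a b -> gsf_net (gitv a b) f Om F ->
  exists k : nat, forall u v, represents u a -> represents v b ->
  \forall e \near 0^'+, forall r, u e <= r <= v e -> `|F e r| <= (rho e)^-1 ^+ k.
Proof.
move=> ab fF.
have le_ab u v : represents u a -> represents v b ->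
    \forall e \near 0^'+, u e <= v e.
  move=> ua vb; have [k hk] := glt_near ab ua vb; near=> e.
  rewrite -subr_ge0 (@le_trans _ _ (rho e ^+ k)) ?exprn_ge0//.
    by rewrite ltW//; near: e; exact: gauge_gt0.
  by near: e.
have [u ua] := represents_exists a; have [v vb] := represents_exists b.
have [k hk] := gsf_net_bound fF ua vb (le_ab _ _ ua vb) 0.
exists k.+1 => u' v' ua' vb'; apply: (near_itv ua' vb' (le_ab _ _ ua' vb')).
move=> y t aby ty.
(* Clamping to the reference segment [u, v] preserves the class, as [t] overshoots by a negligible
   amount. The values of [F] at [t] and [t'] then differ by at most 1, which the exponent [k.+1]
   absorbs. *)
pose t' e := Num.min (Num.max (t e) (u e)) (v e).
have t'uv : \forall e \near 0^'+, u e <= t' e <= v e.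
  near=> e; have uve : u e <= v e by near: e; exact: le_ab.
  by rewrite /t' le_min uve le_max lexx orbT/= ge_min lexx orbT.
have t'y : represents t' y.
  apply: (represents_near ty) => j; case: aby => ay yb; near=> e.
  have uve : u e <= v e by near: e; exact: le_ab.
  have h1 : u e <= t e + rho e ^+ j by near: e; exact: gle_near ay ua ty.
  have h2 : t e <= v e + rho e ^+ j by near: e; exact: gle_near yb ty vb.
  have h3 : 0 <= rho e ^+ j by rewrite exprn_ge0// ltW//; near: e; exact: gauge_gt0.
  rewrite /t' ler_norml; case: (lerP (t e) (u e)) => h4.
    by rewrite min_l//; apply/andP; split; lra.
  by case: (lerP (t e) (v e)) => h5; apply/andP; split; lra.
case: fF => _ _ hF _; near=> e.
have r0 : 0 < rho e by near: e; exact: gauge_gt0.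
have r1 : rho e < 1/2 by near: e; exact: gauge_lt.
have h1 : `|F e (t' e)| <= (rho e)^-1 ^+ k.
  have hb : forall r, u e <= r <= v e -> `|F e r| <= (rho e)^-1 ^+ k.
    by near: e; exact: hk.
  by apply: hb; near: e; exact: t'uv.
have h2 : `|F e (t e) - F e (t' e)| <= rho e ^+ 0.
  by near: e; exact: represents_close (hF _ _ aby ty) (hF _ _ aby t'y).
have i1 : 1 <= (rho e)^-1 ^+ k by rewrite exprn_ege1// invf_ge1//; lra.
have i2 : 2 <= (rho e)^-1.
  by rewrite -[leLHS]invrK lef_pV2 ?posrE ?invr_gt0//; lra.
have : 2 * (rho e)^-1 ^+ k <= (rho e)^-1 * (rho e)^-1 ^+ k.
  by rewrite ler_wpM2r// ltW// (lt_le_trans ltr01).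
rewrite expr0 in h2; rewrite exprS.
have := ler_normD (F e (t e) - F e (t' e)) (F e (t' e)); rewrite subrK; lra.
Unshelve. all: by end_near. Qed.

End Points.

(** * The contradiction at a fixed index, in powers of p *)

Section Test.
Set Implicit Arguments.
Unset Strict Implicit.
Context {R : realType}.
Notation mu := (@lebesgue_measure R).

(** Here [p] stands for [rho e]. [H], [u] and [w] come from the hypothesis on the integral, so they
    match [F] times the bump, [al] and [be] only up to small errors. The exponent [E] collects the
    lower bound on [F] ([N.+1]), the polynomial factor ([L.+1 * 4]), the bell ([m]) and the radius
    of the core ([L.+2]); [Q] and [m] make each error [p ^+ E.+1] after integration. *)
Lemma bell_bump_test (F H : R -> R) (p u w al be xi c : R) (N L m k0 k1 k2 E Q : nat) :
  0 < p -> p <= 1/8 ->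
  (k1 + N.+1 <= L)%N ->
  E = (N.+1 + L.+1 * 4 + m + L.+2)%N ->
  Q = (k2 + E.+1)%N ->
  (m + m = k0 + k2 * 4 + k2 + E.+1)%N ->
  al <= xi <= be -> al <= c - p ^+ L / 2 -> c + p ^+ L / 2 <= be ->
  `|c - xi| <= p ^+ L / 2 ->
  (forall r, al <= r <= be -> derivable F r 1) ->
  (forall r, al <= r <= be -> `|derive1 F r| <= p^-1 ^+ k1) ->
  (forall r, u <= r <= w -> `|F r| <= p^-1 ^+ k0) ->
  be - al + 2 <= p^-1 ^+ k2 ->
  `|u - al| <= p ^+ L.+1 -> `|w - be| <= p ^+ L.+1 ->
  {within `[u, w], continuous H} ->
  (forall r, u <= r <= w ->
    `|H r - F r * bell_bump al be (p^-1 ^+ L.+2) c m r| <= p ^+ Q) ->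
  `|\int[mu]_(r in `[u, w]) H r| <= p ^+ Q ->
  `|F xi| <= p ^+ N.
Proof.
move=> p0 p8 hL hE hQ hm xiab ca cb cxi dF F1 F0 ab2 ua wb cH HF intH.
rewrite leNgt; apply/negP => Fxi.
pose b := bell_bump al be (p^-1 ^+ L.+2) c m.
pose d := p ^+ L; pose r0 := p ^+ L.+2; rewrite -/d in ca cb cxi.
have pge j : 0 < p ^+ j by rewrite exprn_gt0.
have ple i j : (i <= j)%N -> p ^+ j <= p ^+ i.
  by move=> ij; apply: ler_wiXn2l ij; [exact: ltW|lra].
have pS j : p ^+ j.+1 <= p ^+ j / 8.
  by rewrite exprS mulrC ler_pM2l//; lra.
have p1 j : p ^+ j <= 1 by rewrite -(expr0 p); exact: ple.
(* Multiplying by this sign reduces both cases to a positive value at [xi]. *)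
pose sg := Num.sg (F xi).
have sg1 : `|sg| = 1.
  rewrite normr_sg; have : F xi != 0 by rewrite -normr_gt0 (lt_trans _ Fxi).
  by move=> ->.
have sgF : sg * F xi = `|F xi| by rewrite [RHS]normrEsg.
(* Such [r] lies within [d] of [xi], so by the Lipschitz bound and the choice of [L] the value of
   [F] moves by at most [p ^+ N.+1], a small part of [p ^+ N]. *)
have middle r : `|r - c| <= d / 2 -> p ^+ N.+1 <= sg * F r.
  move=> rc; have rab : al <= r <= be.
    by move: rc; rewrite ler_norml => /andP[? ?]; apply/andP; split; lra.
  have rxi : `|r - xi| <= d.
    by rewrite (le_trans (ler_distD c _ _))//; lra.
  have K : `|F r - F xi| <= p ^+ N.+1.
    rewrite (le_trans (lipschitz_segment dF F1 rab xiab))//.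
    rewrite (@le_trans _ _ (p^-1 ^+ k1 * d)) ?ler_wpM2l ?exprn_ge0 ?invr_ge0 ?(ltW p0)//.
    rewrite /d -(subnKC hL) -addnA exprVM ?lt0r_neq0//.
    exact: ple (leq_addr _ _).
  have : `|sg * (F r - F xi)| <= p ^+ N.+1 by rewrite normrM sg1 mul1r.
  rewrite mulrBr sgF ler_norml => /andP[h _].
  have := pS N; have := pge N; lra.
have H_lb r : u <= r <= w -> sg * F r * b r - p ^+ Q <= sg * H r.
  move=> /HF; rewrite -[`|_|]mul1r -sg1 -normrM mulrBr ler_norml => /andP[h _].
  by rewrite -mulrA; rewrite /b in h *; lra.
(* The margin 2 in the bound on [be - al] covers the displacement of both endpoints, each at most
   1. *)
have dist r : u <= r <= w -> `|r - al| <= p^-1 ^+ k2 /\ `|r - be| <= p^-1 ^+ k2.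
  move=> /andP[ur rw]; have := p1 L.+1; move: ua wb.
  rewrite !ler_norml => /andP[? ?] /andP[? ?] ?; split; apply/andP; split; lra.
have uw : w - u <= p^-1 ^+ k2.
  by have := p1 L.+1; move: ua wb; rewrite !ler_norml => /andP[? ?] /andP[? ?] ?; lra.
have iE : p^-1 * p = 1 by rewrite mulVf// lt0r_neq0.
have i0 : 0 < p^-1 by rewrite invr_gt0.
have dr : p^-1 ^+ L.+2 * d = p^-1 ^+ 2.
  rewrite -[L.+2]addn2 exprD -mulrA [_ ^+ 2 * _]mulrC mulrA -exprMn.
  by rewrite iE expr1n mul1r.
have rr : p^-1 ^+ L.+2 * r0 = 1 by rewrite -exprMn iE expr1n.
have dS1 : p ^+ L.+1 <= d / 8 := pS L.
have dS2 : r0 <= p ^+ L.+1 / 8 := pS L.+1.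
have d0 : 0 < d := pge L; have r0_gt0 : 0 < r0 := pge L.+2.
(* On this radius the scaled variable is at most 1, and [al] and [be] stay at distance at least
   [d / 2 - r0], which exceeds [p ^+ L.+1]. *)
have core r : c - r0 <= r <= c + r0 ->
    p ^+ (N.+1 + L.+1 * 4 + m) - p ^+ Q <= sg * H r.
  move=> /andP[rc1 rc2].
  have rc : `|r - c| <= r0 by rewrite ler_norml; apply/andP; split; lra.
  have ruw : u <= r <= w.
    by move: ua wb; rewrite !ler_norml => /andP[? ?] /andP[? ?]; apply/andP; split;
       lra.
  have Fr : p ^+ N.+1 <= sg * F r by apply: middle; rewrite (le_trans rc)//; lra.
  apply: le_trans (H_lb _ ruw); rewrite lerD2r -addnA exprD.
  apply: ler_pM => //; rewrite ?exprn_ge0 ?(ltW p0)//.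
  rewrite exprD exprM.
  apply: (@le_trans _ _ ((p ^+ L.+1) ^+ 4 * 2^-1 ^+ m)).
    rewrite ler_wpM2l ?exprn_ge0 ?(ltW p0)// lerXn2r ?nnegrE ?invr_ge0 ?(ltW p0)//.
    lra.
  apply: bell_bump_core_ge.
  - exact: ltW.
  - by lra.
  - by lra.
  - rewrite normrM ger0_norm ?exprn_ge0 ?(ltW i0)// -rr.
    by rewrite ler_wpM2l ?exprn_ge0 ?(ltW i0).
(* First the error of replacing [H], then the tail: the size of [F], the polynomial factor and the
   decay of the bell. Between the core and distance [d / 2] from [c], the sign of [F] suffices. *)
pose B := p ^+ Q + p^-1 ^+ (k0 + k2 * 4) * p ^+ (m + m).
have B0 : 0 <= B by rewrite addr_ge0 ?mulr_ge0 ?exprn_ge0 ?(ltW p0) ?(ltW i0).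
have all_lb r : u <= r <= w -> - B <= sg * H r.
  move=> ruw; apply: le_trans (H_lb _ ruw); rewrite /B opprD addrC lerD2r.
  have [rc|rc] := leP `|r - c| (d / 2).
    rewrite (@le_trans _ _ 0)//.
      by rewrite oppr_le0 mulr_ge0 ?exprn_ge0 ?(ltW p0) ?(ltW i0).
    by rewrite mulr_ge0 ?bell_bump_ge0// (le_trans _ (middle _ rc))// ltW.
  have [ra rb] := dist _ ruw.
  have br : b r <= p^-1 ^+ (k2 * 4) * p ^+ (m + m).
    rewrite exprM addnn -mul2n [p ^+ (2 * m)]exprM.
    apply: bell_bump_tail_le => //.
    rewrite -(real_normK (num_real (_ * (r - c)))) -exprVn lerXn2r ?nnegrE ?(ltW i0)//.
    rewrite normrM ger0_norm ?exprn_ge0 ?(ltW i0)//.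
    apply: (@le_trans _ _ (p^-1 ^+ L.+2 * (d / 2))); last first.
      by rewrite ler_wpM2l ?exprn_ge0 ?(ltW i0)// ltW.
    (* At distance over [d / 2] the scaled variable exceeds [p^-1 ^+ 2 / 2], hence [p^-1]; its
       square gives the decay [p ^+ 2] per power of the bell. *)
    rewrite mulrA dr expr2 -mulrA ler_peMr ?(ltW i0)//.
    have : 2 <= p^-1 by rewrite -[leLHS]invrK lef_pV2 ?posrE ?invr_gt0//; lra.
    lra.
  rewrite lerNl (le_trans (ler_norm _))// normrN (normrM _ (b r)) (normrM sg) sg1 mul1r.
  have b0 : 0 <= b r := bell_bump_ge0 _ _ _ _ _ _.
  rewrite (ger0_norm b0) exprD -mulrA.
  by apply: ler_pM => //; exact: F0.
have h := @Rintegral_bump_ge R (fun r => sg * H r) u (c - r0) (c + r0) w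
  _ B _ _ _ B0 _ core all_lb.
have : (p ^+ (N.+1 + L.+1 * 4 + m) - p ^+ Q) * (c + r0 - (c - r0)) - B * (w - u)
    <= p ^+ Q.
  apply: le_trans (h _ _ _ _) _ => {h}.
  - by move: ua; rewrite ler_norml => /andP[? ?]; lra.
  - by lra.
  - by move: wb; rewrite ler_norml => /andP[? ?]; lra.
  - by move=> r; apply: (continuous_comp (cH r)); exact: mulrl_continuous.
  - rewrite RintegralZl//; last exact: integrable_segment.
    by rewrite (le_trans (ler_norm _))// normrM sg1 mul1r.
have -> : c + r0 - (c - r0) = 2 * p ^+ L.+2 by rewrite /r0; ring.
have e1 : p ^+ (N.+1 + L.+1 * 4 + m) * p ^+ L.+2 = p ^+ E by rewrite hE -exprD.
have e2 : B * (w - u) <= p ^+ E.+1 + p ^+ E.+1.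
  apply: (@le_trans _ _ (B * p^-1 ^+ k2)); first by rewrite ler_wpM2l.
  rewrite /B mulrDl hQ mulrC exprVM ?lt0r_neq0// lerD2l.
  by rewrite mulrAC -exprD hm exprVM ?lt0r_neq0.
have e3 : p ^+ Q <= p ^+ E.+1 by apply: ple; rewrite hQ leq_addl.
have e4 : p ^+ Q * p ^+ L.+2 <= p ^+ E.+1.
  by rewrite (le_trans _ e3)// ler_piMr// ltW.
(* Altogether 2 p^E is at most 5 p^(E+1), against p <= 1/8. *)
have := pS E; have := pge E; lra.
Qed.

End Test.

(** * Choice of the parameters and conclusion *)

Section Main.
Set Implicit Arguments.
Unset Strict Implicit.
Context {R : realType} {rho : gauge R}.
Implicit Types (u v w s t : R -> R) (x y a b : gnum rho).

Lemma rational_netX F m : rational_net rho F ->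
  rational_net rho (fun e r => F e r ^+ m).
Proof.
move=> nF; elim: m => [|m IH]; first exact: (rational_net_cst (moderate_net_cst rho 1)).
rewrite (_ : (fun e r => _) = (fun e r => F e r * F e r ^+ m)).
  exact: rational_netM.
by apply/funext => e; apply/funext => r; rewrite exprS.
Qed.

Lemma rational_net_bell_bump (al be s c : R -> R) m :
  moderate_net rho al -> moderate_net rho be ->
  moderate_net rho s -> moderate_net rho c ->
  rational_net rho (fun e => bell_bump (al e) (be e) (s e) (c e) m).
Proof.
move=> mal mbe ms mc.
have sub v : moderate_net rho v -> rational_net rho (fun e r => r - v e).
  move=> mv; apply: rational_netD; first exact: rational_net_id.
  by apply: (@rational_net_cst _ _ (fun e => - v e)); exact: moderate_netN.
apply: rational_netM; apply: rational_netX.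
  by apply: rational_netM; exact: sub.
exact: rational_net_bell.
Qed.

Lemma moderate_gauge_inv k : moderate_net rho (fun e => (rho e)^-1 ^+ k).
Proof.
apply/moderate_netP; exists k; near=> e.
by rewrite ger0_norm// exprn_ge0// invr_ge0 ltW//; near: e; exact: gauge_gt0.
Unshelve. all: by end_near. Qed.

Lemma orthogonal_GC0_small a b f Om F (al xi be : R -> R) N :
  glt a b -> gsf_net (gitv a b) f Om F ->
  (forall eta : gnum rho -> gnum rho, GC0 a b eta ->
     is_gint (fun x => f x * eta x) a b 0) ->
  represents al a -> represents be b ->
  (\forall e \near 0^'+, al e <= xi e <= be e) ->
  \forall e \near 0^'+, `|F e (xi e)| <= rho e ^+ N.
Proof.
move=> ab fF orth ala beb xiab.
have albe : \forall e \near 0^'+, al e <= be e.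
  by apply: filterS xiab => e /andP[]; exact: le_trans.
have [k3 hk3] := glt_near ab ala beb.
have [k0 hk0] := gsf_net_bound_uniform ab fF.
have [k1 hk1] := gsf_net_bound fF ala beb albe 1.
have [k2 hk2] := represents_bound (representsB beb ala).
(* [k1 + N.+1] controls the variation of [F]; [k3.+1] makes [rho e ^+ L] at most half of
   [be e - al e]. *)
pose L := (k1 + N.+1 + k3.+1)%N.
pose n := (N.+1 + L.+1 * 4 + L.+2)%N.
(* [E] equals [n + m], so the balance required of [m + m] is solved by this [m]. The successor of
   [k2] absorbs the margin 2 in the length. *)
pose m := (k0 + k2.+1 * 4 + k2.+1 + n + 1)%N.
pose E := (N.+1 + L.+1 * 4 + m + L.+2)%N.
pose Q := (k2.+1 + E.+1)%N.
(* The subinterval goes to the side of [xi e] with more room, which is at least half of the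
   segment. *)
pose c e := if xi e - al e <= be e - xi e then xi e + rho e ^+ L / 2
            else xi e - rho e ^+ L / 2.
have cP : \forall e \near 0^'+, [/\ al e <= c e - rho e ^+ L / 2,
    c e + rho e ^+ L / 2 <= be e & `|c e - xi e| <= rho e ^+ L / 2].
  near=> e.
  have r0 : 0 < rho e by near: e; exact: gauge_gt0.
  have r1 : rho e < 1/2 by near: e; exact: gauge_lt.
  have h3 : rho e ^+ k3 <= be e - al e by near: e.
  have /andP[h1 h2] : al e <= xi e <= be e by near: e.
  have d0 : 0 <= rho e ^+ L by rewrite exprn_ge0// ltW.
  have dl : rho e ^+ L <= rho e ^+ k3 / 2.
    rewrite /L exprD (@le_trans _ _ (rho e ^+ k3.+1))//.
      by rewrite ler_piMl ?exprn_ge0 ?exprn_ile1 ?(ltW r0)//; lra.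
    by rewrite exprS mulrC ler_wpM2l ?exprn_ge0 ?(ltW r0)//; lra.
  rewrite /c; case: (leP (xi e - al e) (be e - xi e)) => h4.
    by split; [lra|lra|rewrite addrC addKr ger0_norm//; lra].
  by split; [lra|lra|rewrite addrC addKr normrN ger0_norm//; lra].
have mc : moderate_net rho c.
  apply: (moderate_net_itv (represents_moderate ala) (represents_moderate beb)).
  near=> e; have [h1 h2 _] : [/\ al e <= c e - rho e ^+ L / 2,
      c e + rho e ^+ L / 2 <= be e & `|c e - xi e| <= rho e ^+ L / 2] by near: e.
  have : 0 <= rho e ^+ L by rewrite exprn_ge0// ltW//; near: e; exact: gauge_gt0.
  by move=> h3; apply/andP; split; lra.
pose B e := bell_bump (al e) (be e) ((rho e)^-1 ^+ L.+2) (c e) m.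
have [|eta eta_smooth hB] := @rational_net_GC R rho B.
  exact: (rational_net_bell_bump _ (represents_moderate ala)
    (represents_moderate beb) (moderate_gauge_inv _) mc).
have eta0 : GC0 a b eta.
  split=> //.
    apply: represents_inj (hB _ _ ala) _.
    rewrite (_ : (fun e => _) = 0); first exact: represents0.
    by apply/funext => e; rewrite /B /bell_bump subrr mul0r expr0n mul0r.
  apply: represents_inj (hB _ _ beb) _.
  rewrite (_ : (fun e => _) = 0); first exact: represents0.
  by apply/funext => e; rewrite /B /bell_bump subrr mulr0 expr0n mul0r.
have [Om' [H [u [w [fH ua wb int0]]]]] := orth _ eta0.
have uw : \forall e \near 0^'+, u e <= w e.
  have [k hk] := glt_near ab ua wb; near=> e.
  rewrite -subr_ge0 (@le_trans _ _ (rho e ^+ k)) ?exprn_ge0//.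
    by rewrite ltW//; near: e; exact: gauge_gt0.
  by near: e.
(* At each point of [a, b] both nets represent the same value of f times [eta]; [near_itv] makes
   their closeness uniform. *)
have HF : \forall e \near 0^'+, forall r, u e <= r <= w e ->
    `|H e r - F e r * B e r| <= rho e ^+ Q.
  apply: (near_itv ua wb uw) => y t aby ty.
  case: fF fH => _ _ hF _ [_ _ hH _].
  exact: represents_close (hH _ _ aby ty) (representsM (hF _ _ aby ty) (hB _ _ ty)).
near=> e.
have r0 : 0 < rho e by near: e; exact: gauge_gt0.
have r8 : rho e <= 1/8 by rewrite ltW//; near: e; apply: gauge_lt; lra.
have [c1 c2 c3] : [/\ al e <= c e - rho e ^+ L / 2,
    c e + rho e ^+ L / 2 <= be e & `|c e - xi e| <= rho e ^+ L / 2] by near: e.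
have dF : forall n r, al e <= r <= be e -> derivable (derive1n n (F e)) r 1.
  by near: e; exact: (gsf_net_derivable fF ala beb albe).
have dH : forall n r, u e <= r <= w e -> derivable (derive1n n (H e)) r 1.
  by near: e; exact: (gsf_net_derivable fH ua wb uw).
have uwe : u e <= w e by near: e.
apply: (@bell_bump_test R (F e) (H e) (rho e) (u e) (w e) (al e) (be e) (xi e)
  (c e) N L m k0 k1 k2.+1 E Q) => //.
- by rewrite /L leq_addr.
- by rewrite /E /m /n; lia.
- by near: e.
- exact: (dF 0).
- by near: e.
- by near: e; exact: hk0.
- have : `|be e - al e| <= (rho e)^-1 ^+ k2 by near: e.
  have i8 : 8 <= (rho e)^-1 by rewrite -[leLHS]invrK lef_pV2 ?posrE ?invr_gt0//; lra.
  have i1 : 1 <= (rho e)^-1 ^+ k2 by rewrite exprn_ege1//; lra.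
  have : 8 * (rho e)^-1 ^+ k2 <= (rho e)^-1 ^+ k2.+1.
    by rewrite exprS ler_wpM2r//; lra.
  have := ler_norm (be e - al e); lra.
- by near: e; exact: represents_close ua ala.
- by near: e; exact: represents_close wb beb.
- by apply: derivable_within_continuous => r; rewrite in_itv; exact: (dH 0).
- by near: e.
- have : `|oriented_integral (H e) (u e) (w e) - 0| <= rho e ^+ Q.
    by near: e; exact: represents_close int0 represents0.
  by rewrite /oriented_integral uwe subr0.
Unshelve. all: by end_near. Qed.

End Main.

Theorem lemma37 (R : realType) (rho : gauge R) (a b : gnum rho)
    (f : gnum rho -> gnum rho) :
  glt a b ->
  GC (gitv a b) setT f ->
  (forall eta : gnum rho -> gnum rho, GC0 a b eta ->
     is_gint (fun t => f t * eta t) a b 0) ->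
  forall x : gnum rho, gitv a b x -> f x = 0.
Proof.
move=> ab [_ [Om [F fF]]] orth x abx.
have [al [xi [be [ala xix beb xiab]]]] := gitv_represents abx.
have Fxi : represents (fun e => F e (xi e)) (f x) by case: fF => _ _ hF _; exact: hF.
apply: represents_inj (represents_near Fxi _) represents0 => N.
apply: filterS (orthogonal_GC0_small N ab fF orth ala beb xiab) => e.
by rewrite subr0.
Qed.
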